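(* Let $G$ be a Lie group, $H\subset G$ a closed subgroup, $X:=G/H$, let $(\rho,V)$ be a finite dimensional real representation of $G$, $v_0\in V^H$ an $H$-fixed vector, and $\mu$ a relatively $G$-invariant measure on $X$. Let $\Theta\subset V^\vee\times\Omega_0(G,H)$ be the associated parameter set and $\mathcal{P}=\{p_\theta\}_{\theta\in\Theta}$ the associated family of probability measures on $X$ (all as defined in the context), and assume $\Theta\neq\emptyset$. Consider the following two conditions: (A) The orbit $Gv_0$ is not contained in any proper affine subspace of $V$. (B) Both of the following hold: (1) $v_0\in V$ is cyclic; (2) the contragredient representation $\rho^\vee:G\to GL(V^\vee)$ has no nonzero $G$-fixed vector. Then (A) and (B) are equivalent, and if the correspondence $\Theta\ni\theta\mapsto p_\theta\in\mathcal{P}$ is injective, then (A) and (B) are satisfied. Moreover, if $\Omega_0(G,H)=\{1\}$, the converse also holds: (A) (equivalently (B)) implies that the correspondence $\Theta\ni\theta\mapsto p_\theta\in\mathcal{P}$ is injective.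
   Context: A (finite dimensional real) representation of a Lie group $G$ is a finite dimensional real vector space $V$ with a Lie group homomorphism $\rho:G\to GL(V)$; write $gv:=\rho(g)v$. $V^\vee$ is the dual space, with pairing $\langle\cdot,\cdot\rangle$. $V^H:=\{v\in V: hv=v \text{ for all } h\in H\}$. A vector $v\in V$ is cyclic if $\operatorname{span}\{gv: g\in G\}=V$. The contragredient representation $\rho^\vee$ on $V^\vee$ is given by $\langle\rho^\vee(g)\xi,v\rangle=\langle\xi,g^{-1}v\rangle$. $\Omega_0(G,H):=\{\chi:G\to\mathbb{R}_{>0} : \chi \text{ is a continuous group homomorphism},\ \chi|_H=1\}$. A relatively $G$-invariant measure on $X=G/H$ is a nonzero Radon measure $\mu$ such that each $g\in G$ translates $\mu$ to a positive multiple $c(g)\mu$, with $c:G\to\mathbb{R}_{>0}$ a continuous homomorphism. For $\theta=(\xi,\chi)\in V^\vee\times\Omega_0(G,H)$ define the measure $\tilde p_\theta$ on $X$ by $d\tilde p_\theta(x):=\exp(-\langle\xi,xv_0\rangle)\,\chi(x)\,d\mu(x)$ ($x\in X$); here $xv_0:=gv_0$ and $\chi(x):=\chi(g)$ for $x=gH$, which are well defined since $v_0$ is $H$-fixed and $\chi|_H=1$. Put $$\Theta:=\Big\{\theta\in V^\vee\times\Omega_0(G,H): \int_X d\tilde p_\theta<\infty\Big\},\quad \varphi(\theta):=\log\int_X d\tilde p_\theta,\quad dp_\theta:=e^{-\varphi(\theta)}d\tilde p_\theta\quad(\theta\in\Theta),$$ and $\mathcal{P}:=\{p_\theta\}_{\theta\in\Theta}$.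 *)

(* Defs.v *)
From HB Require Import structures.
From mathcomp Require Import all_boot all_order all_algebra.
From mathcomp Require Import all_classical all_reals all_analysis.

Set Implicit Arguments.
Unset Strict Implicit.
Unset Printing Implicit Defensive.
Import Order.TTheory GRing.Theory Num.Theory.
Import numFieldNormedType.Exports.

Local Open Scope classical_set_scope.
Local Open Scope ring_scope.

Section Smooth.
Context {R : realType} {n : nat} {W : normedModType R}.
Implicit Types (U : set 'rV[R]_n) (f : 'rV[R]_n -> W).

(* All partial derivatives of f of order at most k exist and are continuous at
   the points of U; this is the usual notion only when U is open. *)
Fixpoint Ck_on (k : nat) U f : Prop :=
  (forall x, U x -> {for x, continuous f}) /\
  if k is k'.+1 then
    forall i : 'I_n, (forall x, U x -> derivable f x (delta_mx 0 i)) /\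
                     Ck_on k' U ('D_(delta_mx 0 i) f)
  else True.

Definition smooth_on U f : Prop := forall k, Ck_on k U f.
End Smooth.

(* [chart_inv] is only meaningful on [chart_cod]. *)
Record chart (R : realType) (M : topologicalType) (n : nat) := Chart {
  chart_dom : set M;
  chart_map : M -> 'rV[R]_n;
  chart_inv : 'rV[R]_n -> M }.

Section Manifold.
Context {R : realType}.

Definition chart_cod (M : topologicalType) n (c : chart R M n) : set 'rV[R]_n :=
  chart_map c @` chart_dom c.

Definition is_chart (M : topologicalType) n (c : chart R M n) : Prop :=
  [/\ open (chart_dom c), open (chart_cod c),
      forall x, chart_dom c x -> chart_inv c (chart_map c x) = x,
      forall x, chart_dom c x -> {for x, continuous (chart_map c)} &
      forall y, chart_cod c y -> {for y, continuous (chart_inv c)}].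

Definition smooth_atlas (M : topologicalType) n (A : set (chart R M n)) : Prop :=
  [/\ forall c, A c -> is_chart c,
      forall x, exists2 c, A c & chart_dom c x &
      forall c d, A c -> A d ->
        smooth_on (chart_map c @` (chart_dom c `&` chart_dom d))
                  (chart_map d \o chart_inv c)].

Definition smooth_map (M N : topologicalType) m n
    (A : set (chart R M m)) (B : set (chart R N n)) (f : M -> N) : Prop :=
  continuous f /\
  forall c d, A c -> B d ->
    smooth_on (chart_map c @` (chart_dom c `&` f @^-1` chart_dom d))
              (chart_map d \o f \o chart_inv c).

Definition smooth_fun (M : topologicalType) m (A : set (chart R M m))
    (W : normedModType R) (f : M -> W) : Prop :=
  forall c, A c -> smooth_on (chart_cod c) (f \o chart_inv c).

Definition prod_chart (M N : topologicalType) m n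
    (c : chart R M m) (d : chart R N n) : chart R (M * N)%type (m + n) :=
  {| chart_dom := chart_dom c `*` chart_dom d;
     chart_map := fun p => row_mx (chart_map c p.1) (chart_map d p.2);
     chart_inv := fun y => (chart_inv c (lsubmx y), chart_inv d (rsubmx y)) |}.

Definition prod_atlas (M N : topologicalType) m n
    (A : set (chart R M m)) (B : set (chart R N n)) :
    set (chart R (M * N)%type (m + n)) :=
  [set prod_chart p.1 p.2 | p in A `*` B].
End Manifold.

(* The atlas need not be maximal. *)
HB.mixin Record isLieGroup (R : realType) G of Topological G & Group G := {
  lie_dim : nat;
  lie_atlas : set (chart R G lie_dim);
  lie_hausdorff : hausdorff_space G;
  lie_second_countable : @second_countable G;
  lie_smooth_atlas : smooth_atlas lie_atlas;
  lie_smooth_mul : smooth_map (prod_atlas lie_atlas lie_atlas) lie_atlas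
                              (fun p : G * G => (p.1 * p.2)%g);
  lie_smooth_inv : smooth_map lie_atlas lie_atlas (fun g : G => (g^-1)%g) }.

#[short(type="lieGroupType")]
HB.structure Definition LieGroup (R : realType) :=
  { G of isLieGroup R G & Topological G & Group G }.

Section Representation.
Context {R : realType} {G : lieGroupType R} {V : vectType R}.
Implicit Types (rho : G -> 'End(V)) (v : V) (xi : 'Hom(V, R^o)).

(* GL(V) is open in End(V), whose linear coordinates are spanned by the matrix
   coefficients a |-> xi (a v); smoothness of G -> GL(V) is therefore that of
   the matrix coefficients. *)
Definition lie_representation rho : Prop :=
  [/\ rho 1%g = \1%VF,
      forall g h, rho (g * h)%g = (rho g \o rho h)%VF &
      forall xi v, smooth_fun (lie_atlas : set (chart R G _))
                              (fun g => xi (rho g v))].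

Definition contragredient rho (g : G) xi : 'Hom(V, R^o) :=
  (xi \o rho (g^-1)%g)%VF.

Definition fixed_vectors (W : Type) (act : G -> W -> W) (K : set G) : set W :=
  [set w | forall g, K g -> act g w = w].

Definition orbit_set rho v : set V := range (fun g => rho g v).

Definition linear_span (S : set V) : set V :=
  [set w | exists s : seq V, (forall u, u \in s -> S u) /\ w \in span s].

Definition cyclic_vector rho v : Prop := linear_span (orbit_set rho v) = setT.

Definition affine_subspace (W : set V) : Prop :=
  exists (p : V) (U : {vspace V}), W = [set p + u | u in [set` U]].
End Representation.

Section HomogeneousSpace.
Context {R : realType} {G : lieGroupType R}.
Implicit Type H : groupClosed G.
Local Open Scope quotient_scope.

(* Left cosets: g ~ h iff gH = hH. *)
Definition coset_rel H : rel G := fun g h => (g^-1 * h)%g \in H.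

Lemma coset_rel_equiv H : equiv_class_of (coset_rel H).
Proof.
have sym : symmetric (coset_rel H).
  by move=> g h; rewrite /coset_rel -gpredV invgM invgK.
split=> // [g|h g k].
  by rewrite /coset_rel mulVg gpred1.
rewrite /coset_rel => gh hk.
by rewrite -[k](mulVKg h) mulgA gpredM.
Qed.

Canonical coset_equiv H := EquivRelPack (coset_rel_equiv H).

Definition homogeneous H : Type := quotient_topology {eq_quot (coset_equiv H)}.
HB.instance Definition _ H := Topological.on (homogeneous H).
HB.instance Definition _ H := Quotient.on (homogeneous H).
HB.instance Definition _ H :=
  isPointed.Build (homogeneous H) (\pi_(homogeneous H) 1%g).

Definition borel H : Type := g_sigma_algebraType (@open (homogeneous H)).
HB.instance Definition _ H := Measurable.on (borel H).
HB.instance Definition _ H := Pointed.on (borel H).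

Definition translate H (g : G) (x : homogeneous H) : homogeneous H :=
  \pi_(homogeneous H) (g * repr x)%g.

Lemma repr_pi_coset H (g : G) :
  exists2 h : G, h \in H & repr (\pi_(homogeneous H) g) = (g * h)%g.
Proof.
exists (g^-1 * repr (\pi_(homogeneous H) g))%g; last by rewrite mulVKg.
have /eqmodP : g = repr (\pi_{eq_quot (coset_equiv H)} g)
    %[mod {eq_quot (coset_equiv H)}] by rewrite reprK.
by [].
Qed.

Lemma pi_coset H (g h : G) : h \in H ->
  \pi_(homogeneous H) (g * h)%g = \pi_(homogeneous H) g.
Proof.
move=> hH; apply/esym/(@eqmodP _ (coset_equiv H)).
by rewrite /= /coset_rel mulKg.
Qed.

Lemma translate_pi H (g k : G) :
  translate g (\pi_(homogeneous H) k) = \pi_(homogeneous H) (g * k)%g.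
Proof.
rewrite /translate; have [h hH ->] := repr_pi_coset H k.
by rewrite mulgA (pi_coset (g * k)%g hH).
Qed.
End HomogeneousSpace.

Section RelativelyInvariant.
Context {R : realType} {G : lieGroupType R} {H : groupClosed G}.
Local Open Scope ereal_scope.

(* G / H is locally compact and second countable, so the usual variants of the
   definition of a Radon measure agree. *)
Definition radon_measure (mu : {measure set (borel H) -> \bar R}) : Prop :=
  [/\ forall K : set (homogeneous H), compact K -> mu K < +oo,
      forall A : set (borel H), measurable A ->
        mu A = ereal_inf
          [set mu U | U in [set U : set (homogeneous H) | open U /\ A `<=` U]] &
      forall U : set (homogeneous H), open U ->
        mu U = ereal_sup
          [set mu K | K in [set K : set (homogeneous H) | compact K /\ K `<=` U]]].

Definition positive_character (c : G -> R) : Prop :=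
  [/\ continuous c, forall g, (0 < c g)%R &
      forall g h, c (g * h)%g = (c g * c h)%R].

Definition relatively_invariant (mu : {measure set (borel H) -> \bar R}) : Prop :=
  [/\ radon_measure mu, mu setT != 0 &
      exists2 c : G -> R, positive_character c &
        forall g (A : set (borel H)), measurable A ->
          pushforward mu (translate g : borel H -> borel H) A = (c g)%:E * mu A].
End RelativelyInvariant.

Section Family.
Context {R : realType} {G : lieGroupType R} (H : groupClosed G).
Context {V : vectType R} (rho : G -> 'End(V)) (v0 : V).
Context (mu : {measure set (borel H) -> \bar R}).

Definition Omega0 : set (G -> R) :=
  [set chi | positive_character chi /\ forall h, h \in H -> chi h = 1].

Definition parameter : Type := ('Hom(V, R^o) * (G -> R))%type.
Implicit Type theta : parameter.

(* Evaluated at a representative of x; see [density_pi]. *)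
Definition density theta (x : homogeneous H) : R :=
  expR (- theta.1 (rho (repr x) v0)) * theta.2 (repr x).

Definition ptilde theta (A : set (borel H)) : \bar R :=
  (\int[mu]_(x in A) (density theta x)%:E)%E.

Definition Theta : set parameter :=
  [set theta | Omega0 theta.2 /\ (ptilde theta setT < +oo)%E].

Definition log_partition theta : R := ln (fine (ptilde theta setT)).

Definition p_ theta (A : set (borel H)) : \bar R :=
  ((expR (- log_partition theta))%:E * ptilde theta A)%E.

(* Measures are equal when they agree on measurable sets; the values of [p_]
   elsewhere carry no information. *)
Definition parametrization_injective : Prop :=
  forall theta theta', Theta theta -> Theta theta' ->
    (forall A, measurable A -> p_ theta A = p_ theta' A) -> theta = theta'.

Lemma density_pi theta (g : G) : lie_representation rho ->
  fixed_vectors rho [set` H] v0 -> Omega0 theta.2 ->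
  density theta (\pi_(homogeneous H)%qT g) =
  expR (- theta.1 (rho g v0)) * theta.2 g.
Proof.
move=> [_ rhoM _] v0H [[_ _ chiM] chiH].
rewrite /density; have [h hH ->] := repr_pi_coset H g.
by rewrite rhoM lfunE /= (v0H h)// chiM (chiH h)// mulr1.
Qed.
End Family.

(* Main.v *)
Require Import Defs.
From mathcomp Require Import all_boot all_order all_algebra.
From mathcomp Require Import all_classical all_reals all_analysis.
From mathcomp Require Import measurable_realfun lra.
Import Order.TTheory GRing.Theory Num.Theory.
Import numFieldNormedType.Exports.
Local Open Scope classical_set_scope.
Local Open Scope ring_scope.

(** The whole statement is about linear functionals xi <> 0 on V that are
    constant along the orbit G v0.

    Such a functional exists exactly when the orbit lies in a proper affine
    subspace: the level sets of xi are proper affine subspaces, and conversely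
    the direction of a proper affine subspace is killed by some xi <> 0
    ([proper_affine_hullP]). It also exists exactly when (B) fails. If the orbit
    spans a proper subspace, take a functional vanishing on it; if xi is fixed by
    the contragredient representation, then xi is constant on every orbit; and if
    v0 is cyclic, a functional constant on G v0 agrees with each of its
    translates on a spanning set, hence is fixed
    ([spanning_orbit_no_constantP]). So (A) and (B) are equivalent.

    Adding to the parameter a functional with constant value c on the orbit
    multiplies the density by exp(-c), and the normalization cancels this factor.
    Hence injectivity forbids such a functional, which is (A)
    ([shift_constant_on_orbit]).

    Conversely, suppose that p_theta = p_theta' and that both characters are
    trivial. The normalized densities agree mu-almost everywhere. They are
    continuous, and a relatively invariant measure charges every nonempty open
    set, so they agree everywhere ([p_eq_density]). Taking logarithms, xi - xi' is
    constant on the orbit, so (A) forces xi = xi'. A nonzero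
    relatively invariant measure has no nonempty open null set U, because countably
    many translates of U, all null, would cover the second countable space G / H
    ([relatively_invariant_null_open]). *)

(** * Separating functionals *)

Section LinearAlgebra.
Context {R : realType} {V : vectType R}.

(** The projection onto a complement of U kills U and is nonzero outside U, so
    one of its coordinates is the required functional. *)
Lemma functional_separation (U : {vspace V}) : U <> fullv ->
  exists2 xi : 'Hom(V, R^o), xi <> 0 & forall u, u \in U -> xi u = 0.
Proof.
move=> Uproper.
have [w wU] : exists w, w \notin U.
  apply: contrapT => /forallNP inU; apply: Uproper; apply/vspaceP => w.
  by rewrite memvf; apply/negPn/negP/inU.
pose b := vbasis (fullv : {vspace V}).
have [i wi] : exists i, coord b i (w - projv U w) != 0.
  apply: contrapT => /forallNP h; move/negP: wU; apply.
  suff /eqP : w - projv U w = 0.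
    by rewrite subr_eq0 => /eqP ->; exact: memv_proj.
  rewrite (coord_vbasis (memvf (w - _))) big1// => i _.
  by move/negP/negPn/eqP: (h i) => ->; rewrite scale0r.
exists (linfun (coord b i : V -> R^o) \o (\1 - projv U))%VF => [xi0|u uU].
  move/eqP: wi; apply.
  have := congr1 (fun xi : 'Hom(V, R^o) => xi w) xi0.
  by rewrite comp_lfunE lfunE /= add_lfunE opp_lfunE id_lfunE zero_lfunE.
by rewrite comp_lfunE lfunE /= add_lfunE opp_lfunE id_lfunE projv_id// subrr
   linear0.
Qed.

End LinearAlgebra.

(** * Invariant measures on homogeneous spaces *)

(** The Lindelof property. For each basic open set contained in some member of
    the cover, choose one such member; an injection of the basis into nat turns
    the choices into a sequence, in which i0 fills the unused indices. *)
Lemma lindelof_indexed (T : topologicalType) (I : Type) (i0 : I)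
    (F : I -> set T) :
  @second_countable T -> (forall i, open (F i)) ->
  (forall x, exists i, F i x) ->
  exists e : nat -> I, forall x, exists n, F (e n) x.
Proof.
move=> [B /countable_injP[f finj] [_ Bbasis]] Fo Fcov.
have pick n : exists i, forall U, B U -> f U = n ->
    (exists j, U `<=` F j) -> U `<=` F i.
  have [[U [BU fU [j Uj]]]|no] :=
      pselect (exists U, [/\ B U, f U = n & exists j, U `<=` F j]).
    exists j => U' BU' fU' _.
    by rewrite (finj U' U) ?inE// fU' fU.
  by exists i0 => U BU fU Uj; case: no; exists U; split.
have [e eP] := choice pick.
exists e => x; have [i Fix] := Fcov x.
have [U [BU Ux] UF] : filter_from [set U | B U /\ U x] id (F i).
  by apply: Bbasis; apply: open_nbhs_nbhs; split.
exists (f U); apply: (eP (f U) U BU erefl _ x Ux).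
by exists i.
Qed.

Section Homogeneous.
Context {R : realType} {G : lieGroupType R} {H : groupClosed G}.
Local Open Scope quotient_scope.

Lemma continuous_mulg (g : G) : continuous (fun k : G => (g * k)%g).
Proof.
have [mulc _] := @lie_smooth_mul R G.
move=> k; apply: (@continuous_comp _ _ _ (fun k : G => (g, k))
    (fun p : G * G => (p.1 * p.2)%g)).
  by apply: cvg_pair; [exact: cvg_cst|exact: cvg_id].
exact: mulc.
Qed.

Lemma continuous_translate (g : G) :
  continuous (translate g : homogeneous H -> _).
Proof.
apply/quotient_continuous.
rewrite (_ : _ \o _ = \pi_(homogeneous H) \o (fun k : G => (g * k)%g)).
  move=> k; apply: continuous_comp; first exact: continuous_mulg.
  exact: pi_continuous.
by apply/funext => k /=; rewrite translate_pi.
Qed.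

Lemma open_borel (U : set (homogeneous H)) :
  open U -> measurable (U : set (borel H)).
Proof. exact: sub_gen_smallest. Qed.

Lemma continuous_borel_measurable (f : homogeneous H -> R) :
  continuous f -> measurable_fun setT (f : borel H -> R).
Proof.
move=> /continuousP cf mD.
apply: (measurability _ (RGenOpens.measurableE R)) => //.
move=> _ [_ [a [b ->] <-]].
rewrite setTI; apply: open_borel; apply: cf; exact: interval_open.
Qed.

Lemma measurable_continuous_EFin (f : homogeneous H -> R) : continuous f ->
  measurable_fun setT (fun x : borel H => (f x)%:E).
Proof.
by move=> cf; apply/measurable_EFinP; exact: continuous_borel_measurable.
Qed.

(** Full support. Every point of G / H is sent into U by some element of G, so
    the preimages of U under translations cover G / H, and they are null by
    relative invariance. The countable subcover is extracted upstairs, in G,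
    whose second countability is part of the structure. *)
Lemma relatively_invariant_null_open (mu : {measure set (borel H) -> \bar R}) :
  relatively_invariant mu -> forall U : set (homogeneous H), open U ->
  mu U = 0%E -> U = set0.
Proof.
move=> [_ muT [c _ cP]] U Uo U0.
apply: contrapT => /eqP/set0P[x Ux].
pose k0 : G := repr x.
(* The translation by k0 * g^-1 sends the coset of g to that of k0, which is x. *)
pose T (g : G) : set (borel H) := translate (k0 * g^-1)%g @^-1` U.
have To g : open (T g : set (homogeneous H)).
  by move/continuousP: (continuous_translate (k0 * g^-1)%g); apply.
have T0 g : mu (T g) = 0%E.
  rewrite -[LHS]/(pushforward mu
    (translate (k0 * g^-1)%g : borel H -> borel H) U).
  rewrite cP ?U0 ?mule0//; exact: open_borel.
have [e eP] : exists e : nat -> G, forall k, exists n,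
    (\pi_(homogeneous H) @^-1` T (e n)) k.
  apply: (@lindelof_indexed G G 1%g (fun g => \pi_(homogeneous H) @^-1` T g)).
  - exact: lie_second_countable.
  - by move=> g; apply: To.
  - by move=> k; exists k; rewrite /T /= translate_pi mulgVK /k0 reprK.
have : mu.-negligible [set: borel H].
  have -> : [set: borel H] = \bigcup_n T (e n).
    apply/esym; rewrite -subTset => y _.
    by have [n] := eP (repr y); rewrite /= reprK => yn; exists n.
  apply: negligible_bigcup => n; apply/negligibleP; [exact: open_borel|exact: T0].
by move/negligibleP => /(_ measurableT) /eqP; exact/negP.
Qed.
End Homogeneous.

(** * Functionals constant on an orbit *)

(** Smoothness is stated on charts; near a point of a chart domain, f is the
    composite of its local expression with the chart. *)
Lemma smooth_fun_continuous {R : realType} {M : topologicalType} {n : nat}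
    (A : set (chart R M n)) (W : normedModType R) (f : M -> W) :
  smooth_atlas A -> smooth_fun A f -> continuous f.
Proof.
move=> [Achart Acov _] fA x.
have [c Ac cx] := Acov x.
have [domo _ mapK mapc _] := Achart c Ac.
have [fc _] := fA c Ac 0%N.
have near_dom : \forall y \near x, chart_dom c y.
  by apply: open_nbhs_nbhs; split.
suff : f \o chart_inv c \o chart_map c @ x --> f x.
  apply: cvg_trans; apply: near_eq_cvg.
  by near=> y; rewrite /= mapK//; near: y.
rewrite -{2}(mapK x cx).
apply: (@continuous_comp _ _ _ (chart_map c) (f \o chart_inv c)).
  exact: mapc.
by apply: fc; exists x.
Unshelve. all: by end_near.
Qed.

Section Orbit.
Context {R : realType} {G : lieGroupType R} {V : vectType R}.
Variables (rho : G -> 'End(V)) (v0 : V).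
Hypothesis rhoP : lie_representation rho.

Definition constant_on_orbit (xi : 'Hom(V, R^o)) : Prop :=
  forall g, xi (rho g v0) = xi v0.

(** (A) in terms of functionals: a proper affine subspace has a proper direction,
    which a nonzero functional kills, and the translate of a hyperplane lker xi
    is such a subspace. *)
Lemma proper_affine_hullP :
  (exists W : set V, [/\ affine_subspace W, W <> setT & orbit_set rho v0 `<=` W])
  <-> exists2 xi : 'Hom(V, R^o), xi <> 0 & constant_on_orbit xi.
Proof.
have [rho1 _ _] := rhoP.
split=> [[_ [[p [U ->]] UT orbU]]|[xi xi0 xic]].
  have [|xi xi0 xiU] := @functional_separation _ _ U.
    move=> Ufull; apply: UT; rewrite -subTset => w _.
    by exists (w - p); rewrite /= ?Ufull ?memvf// addrC subrK.
  have xip g : xi (rho g v0) = xi p.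
    have [u /= uU <-] : [set p + u | u in [set` U]] (rho g v0).
      by apply: orbU; exists g.
    by rewrite linearD /= (xiU u uU) addr0.
  by exists xi => // g; rewrite xip -(xip 1%g) rho1 id_lfunE.
exists [set v0 + u | u in [set` lker xi]]; split.
- by exists v0, (lker xi).
- move=> WT; apply: xi0; apply/lfunP => w; rewrite zero_lfunE.
  have [u /= + uw] : [set v0 + u | u in [set` lker xi]] (v0 + w) by rewrite WT.
  by move: uw => /addrI ->; rewrite memv_ker => /eqP.
- move=> _ [g _ <-]; exists (rho g v0 - v0); last by rewrite addrC subrK.
  by rewrite /= memv_ker linearB /= xic subrr.
Qed.

(** [linear_span] is a mere set, so it is first replaced by a subspace: the span
    of a finite family of orbit points of maximal dimension contains the orbit. *)
Lemma not_cyclic_separation : ~ cyclic_vector rho v0 ->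
  exists2 xi : 'Hom(V, R^o), xi <> 0 & forall g, xi (rho g v0) = 0.
Proof.
move=> ncyc.
pose P (n : nat) := `[< exists2 es : seq V,
  (forall u, u \in es -> orbit_set rho v0 u) & \dim <<es>> = n >].
have P0 : exists n, P n.
  by exists 0%N; apply/asboolP; exists nil; rewrite ?span_nil ?dimv0.
have Pub n : P n -> (n <= \dim {:V})%N.
  by move=> /asboolP[es _ <-]; rewrite dimvS ?subvf.
have [n /asboolP[es sorb sn] nmax] := ex_maxnP P0 Pub.
have orbs g : rho g v0 \in <<es>>%VS.
  have sub : (<<es>> <= <<rho g v0 :: es>>)%VS.
    by apply: sub_span => u us; rewrite inE us orbT.
  suff /eqP -> : (<<es>> == <<rho g v0 :: es>>)%VS.
    by rewrite memv_span// mem_head.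
  rewrite eqEdim sub /= sn; apply: nmax; apply/asboolP.
  exists (rho g v0 :: es) => // u; rewrite inE => /predU1P[->|/sorb//].
  by exists g.
have [|xi xi0 xis] := @functional_separation _ _ <<es>>%VS.
  move=> sfull; apply: ncyc; rewrite /cyclic_vector -subTset => w _.
  by exists es; split=> //; rewrite sfull memvf.
by exists xi => // g; apply: xis.
Qed.

(** (B) in terms of functionals: the two halves of (B) respectively exclude
    functionals vanishing on the orbit and invariant functionals, and for cyclic
    v0 a functional constant on the orbit is invariant. *)
Lemma spanning_orbit_no_constantP :
  (~ exists2 xi : 'Hom(V, R^o), xi <> 0 & constant_on_orbit xi) <->
  (cyclic_vector rho v0 /\
   ~ exists xi : 'Hom(V, R^o),
       xi <> 0 /\ fixed_vectors (contragredient rho) setT xi).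
Proof.
have [rho1 rhoM _] := rhoP.
split=> [noconst|[cyc nofix] [xi xi0 xic]].
  split.
    apply: contrapT => /not_cyclic_separation[xi xi0 xi_orb]; apply: noconst.
    exists xi => // g; rewrite xi_orb.
    by have := xi_orb 1%g; rewrite rho1 id_lfunE.
  move=> [xi [xi0 xifix]]; apply: noconst; exists xi => // g.
  have := congr1 (fun f : 'Hom(V, R^o) => f v0) (xifix g^-1%g I).
  by rewrite /contragredient comp_lfunE invgK.
apply: nofix; exists xi; split=> // g _; apply/lfunP => w.
have [es [sorb ws]] : linear_span (orbit_set rho v0) w by rewrite cyc.
suff /subvP /(_ w ws) : (<<es>> <= lker (contragredient rho g xi - xi))%VS.
  by move/eqlfunP.
apply/span_subvP => u /sorb[k _ <-]; apply/eqlfunP.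
by rewrite /contragredient comp_lfunE -(comp_lfunE (rho _)) -rhoM !xic.
Qed.
End Orbit.

(** * The exponential family *)

Lemma expR_mul_inj {R : realType} (a b c d : R) :
  expR a * expR b = expR c * expR d -> a + b = c + d.
Proof. by rewrite -!expRD => /expR_inj. Qed.

Section Family.
Context {R : realType} {G : lieGroupType R} (H : groupClosed G).
Context {V : vectType R} (rho : G -> 'End(V)) (v0 : V).
Context (mu : {measure set (borel H) -> \bar R}).
Hypothesis rhoP : lie_representation rho.
Hypothesis v0H : fixed_vectors rho [set` H] v0.
Hypothesis muP : relatively_invariant mu.

(** By the universal property of the quotient, continuity can be checked on G,
    where the choice of representatives disappears. *)
Lemma density_continuous (theta : parameter) :
  Omega0 H theta.2 -> continuous (density rho v0 theta : homogeneous H -> R).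
Proof.
move=> thetaO; have [[chic _ _] _] := thetaO; have [_ _ rhoS] := rhoP.
apply/quotient_continuous.
rewrite (_ : _ \o _ =
    (fun g => expR (- theta.1 (rho g v0)) * theta.2 g)); last first.
  by apply/funext => g; rewrite /= density_pi.
have xic : continuous (fun g => theta.1 (rho g v0) : R^o).
  by apply: smooth_fun_continuous (rhoS _ _); exact: lie_smooth_atlas.
move=> g; apply: cvgM; last exact: chic.
apply: continuous_comp; last exact: continuous_expR.
by apply: cvgN; exact: xic.
Qed.

Lemma density_gt0 (theta : parameter) (x : homogeneous H) :
  Omega0 H theta.2 -> 0 < density rho v0 theta x.
Proof. by move=> [[_ chi0 _] _]; rewrite mulr_gt0 ?expR_gt0. Qed.

Lemma measurable_density (theta : parameter) (A : set (borel H)) :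
  Omega0 H theta.2 ->
  measurable_fun A (fun x : borel H => (density rho v0 theta x)%:E).
Proof.
move=> thetaO; apply: measurable_funTS.
apply: measurable_continuous_EFin; exact: density_continuous.
Qed.

(** The density is everywhere positive, so a zero integral would force the whole
    space to be null. Positivity is what makes [log_partition] a genuine
    normalization, as [ln] is only meaningful on positive reals. *)
Lemma ptilde_fin_gt0 (theta : parameter) : Theta rho v0 mu theta ->
  exists2 r : R, 0 < r & ptilde rho v0 mu theta setT = r%:E.
Proof.
move=> [thetaO fin].
have ge0 : (0 <= ptilde rho v0 mu theta setT)%E.
  by apply: integral_ge0 => x _; rewrite lee_fin ltW// density_gt0.
exists (fine (ptilde rho v0 mu theta setT)); last by rewrite fineK// ge0_fin_numE.
apply: fine_gt0; rewrite fin andbT lt_def ge0 andbT.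
apply/negP => /eqP I0.
have : ae_eq mu setT (fun x : borel H => (density rho v0 theta x)%:E) (cst 0%E).
  apply/ae_eq_integral_abs => //; first exact: measurable_density.
  rewrite -[RHS]I0; apply: eq_integral => x _.
  by rewrite /= ger0_norm// ltW// density_gt0.
move=> /(negligibleS _) => /(_ setT) null.
have /negligibleP : mu.-negligible [set: borel H].
  apply: null => x _ /= /(_ I) [] /eqP.
  by rewrite gt_eqF// density_gt0.
by move=> /(_ measurableT)/eqP; have [_ /negPf ->] := muP.
Qed.

Lemma integral_density_scale (theta : parameter) (c : R) (A : set (borel H)) :
  Omega0 H theta.2 -> 0 <= c -> measurable A ->
  (\int[mu]_(x in A) (c * density rho v0 theta x)%:E)%E =
  (c%:E * ptilde rho v0 mu theta A)%E.
Proof.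
move=> thetaO c0 mA.
apply: (@ge0_integralZl _ _ _ mu A mA
  (fun x : borel H => (density rho v0 theta x)%:E) _ c%:E).
- exact: measurable_density.
- by move=> x _; rewrite lee_fin ltW// density_gt0.
- by rewrite lee_fin.
Qed.

(** The shifted density is exp(- xi v0) times the old one, and so is its total
    mass; the factors cancel in the normalized measure. *)
Lemma shift_constant_on_orbit (xi : 'Hom(V, R^o)) (theta : parameter) :
  constant_on_orbit rho v0 xi -> Theta rho v0 mu theta ->
  Theta rho v0 mu (theta.1 + xi, theta.2) /\
  forall A, measurable A ->
    p_ rho v0 mu (theta.1 + xi, theta.2) A = p_ rho v0 mu theta A.
Proof.
move=> xic thetaT; have [thetaO fin] := thetaT.
have shift A : measurable A -> ptilde rho v0 mu (theta.1 + xi, theta.2) A =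
    ((expR (- xi v0))%:E * ptilde rho v0 mu theta A)%E.
  move=> mA; rewrite -integral_density_scale ?expR_ge0//.
  apply: eq_integral => x _; rewrite /density /= add_lfunE xic.
  by rewrite opprD expRD mulrA [expR (- xi _) * _]mulrC.
have [r r0 rE] := ptilde_fin_gt0 theta thetaT.
split=> [|A mA].
  split; first exact: thetaO.
  by rewrite (shift _ measurableT) rE -EFinM ltry.
rewrite /p_ /log_partition !shift// rE -EFinM /= muleA -EFinM.
congr (_%:E * _)%E.
rewrite lnM ?posrE ?expR_gt0// expRK opprD opprK expRD.
by rewrite mulrAC -expRD subrr expR0 mul1r.
Qed.

Lemma injective_no_constant : Theta rho v0 mu !=set0 ->
  parametrization_injective rho v0 mu ->
  ~ exists2 xi : 'Hom(V, R^o), xi <> 0 & constant_on_orbit rho v0 xi.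
Proof.
move=> [theta thetaT] inj [xi xi0 xic]; apply: xi0.
have [thetaT' pE] := shift_constant_on_orbit _ _ xic thetaT.
have /(congr1 fst) /= := inj _ _ thetaT' thetaT pE.
by move/eqP; rewrite -subr_eq0 addrAC subrr add0r => /eqP.
Qed.

(** Equality of the integrals over all measurable sets gives almost everywhere
    equality; the set where the two continuous functions differ is open and
    null, hence empty by full support. *)
Lemma p_eq_density (theta theta' : parameter) :
  Theta rho v0 mu theta -> Theta rho v0 mu theta' ->
  (forall A, measurable A -> p_ rho v0 mu theta A = p_ rho v0 mu theta' A) ->
  forall x : homogeneous H,
    expR (- log_partition rho v0 mu theta) * density rho v0 theta x =
    expR (- log_partition rho v0 mu theta') * density rho v0 theta' x.
Proof.
move=> thetaT thetaT' pE x.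
pose f t (x : homogeneous H) : R :=
  expR (- log_partition rho v0 mu t) * density rho v0 t x.
have fc t : Theta rho v0 mu t -> continuous (f t).
  move=> [tO _] y.
  exact: (cvgM (cvg_cst _) (density_continuous t tO y)).
have mf t : Theta rho v0 mu t ->
    measurable_fun setT (fun x : borel H => (f t x)%:E).
  by move=> tT; apply: measurable_continuous_EFin; exact: fc.
have f0 t y : Theta rho v0 mu t -> 0 <= f t y.
  by move=> [tO _]; rewrite mulr_ge0 ?expR_ge0// ltW// density_gt0.
have fp t A : Theta rho v0 mu t -> measurable A ->
    (\int[mu]_(y in A) (f t y)%:E)%E = p_ rho v0 mu t A.
  by move=> [tO _] mA; rewrite integral_density_scale ?expR_ge0.
have fi : mu.-integrable setT (fun x : borel H => (f theta x)%:E).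
  apply/integrableP; split; first exact: mf.
  under eq_integral => y _ do rewrite /= ger0_norm ?f0//.
  rewrite fp// /p_; have [r _ ->] := ptilde_fin_gt0 theta thetaT.
  by rewrite -EFinM ltry.
have ae : ae_eq mu setT (fun x : borel H => (f theta x)%:E)
    (fun x : borel H => (f theta' x)%:E).
  apply: integral_ae_eq => //; first exact: mf.
  by move=> E _ mE; rewrite (fp _ _ thetaT mE) (fp _ _ thetaT' mE) pE.
pose D : set (homogeneous H) := [set y | f theta y - f theta' y != 0].
have Do : open D.
  have dc : continuous (fun y => f theta y - f theta' y).
    by move=> y; exact: (cvgB (fc _ thetaT y) (fc _ thetaT' y)).
  move/continuousP: dc => /(_ [set r | r != 0]); apply.
  exact: open_neq.
have : D = set0.
  apply: (relatively_invariant_null_open mu muP) => //.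
  apply/(negligibleP mu); first exact: open_borel.
  apply: negligibleS ae => y; rewrite /D /= => /negP fy ff; apply: fy.
  by case: (ff I) => ->; rewrite subrr.
apply: contraPP => /eqP fneq.
by apply/eqP/set0P; exists x; rewrite /D /= subr_eq0.
Qed.

(** With trivial characters, the logarithm of the equality of densities reads
    xi (g v0) - xi' (g v0) = l' - l, where the right-hand side is the difference
    of the log-partition values, independent of g. *)
Lemma no_constant_injective : Omega0 H = [set cst 1] ->
  ~ (exists2 xi : 'Hom(V, R^o), xi <> 0 & constant_on_orbit rho v0 xi) ->
  parametrization_injective rho v0 mu.
Proof.
move=> Omega1 noconst [xi chi] [xi' chi'] thetaT thetaT' pE.
have chi1 : chi = cst 1 by case: thetaT; rewrite Omega1.
have chi1' : chi' = cst 1 by case: thetaT'; rewrite Omega1.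
subst chi chi'.
have [rho1 _ _] := rhoP.
pose l := log_partition rho v0 mu (xi, cst 1).
pose l' := log_partition rho v0 mu (xi', cst 1).
have densityE (zeta : 'Hom(V, R^o)) g : Omega0 H (cst 1) ->
    density rho v0 (zeta, cst 1) (\pi_(homogeneous H)%qT g) =
    expR (- zeta (rho g v0)).
  by move=> O1; rewrite density_pi// mulr1.
have O1 : Omega0 H (cst 1) by case: thetaT.
have diff g : (xi - xi') (rho g v0) = l' - l.
  have := p_eq_density _ _ thetaT thetaT' pE (\pi_(homogeneous H)%qT g).
  rewrite (densityE xi g O1) (densityE xi' g O1).
  move=> /expR_mul_inj E.
  rewrite add_lfunE opp_lfunE.
  suff : - l - xi (rho g v0) = - l' - xi' (rho g v0) :> R by lra.
  exact: E.
suff -> : xi = xi' by [].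
apply: contrapT => neq; apply: noconst; exists (xi - xi').
  by move/eqP; rewrite subr_eq0 => /eqP.
by move=> g; rewrite diff -(diff 1%g) rho1 id_lfunE.
Qed.
End Family.

Theorem proposition1 (R : realType) (G : lieGroupType R) (H : groupClosed G)
    (V : vectType R) (rho : G -> 'End(V)) (v0 : V)
    (mu : {measure set (borel H) -> \bar R}) :
  closed [set` H] ->
  lie_representation rho ->
  fixed_vectors rho [set` H] v0 ->
  relatively_invariant mu ->
  Theta rho v0 mu !=set0 ->
  let condA :=
    ~ exists W : set V,
        [/\ affine_subspace W, W <> setT & orbit_set rho v0 `<=` W] in
  let condB :=
    cyclic_vector rho v0 /\
    ~ exists xi : 'Hom(V, R^o),
        xi <> 0 /\ fixed_vectors (contragredient rho) setT xi in
  [/\ condA <-> condB,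
      parametrization_injective rho v0 mu -> condA /\ condB &
      Omega0 H = [set cst 1] -> condA -> parametrization_injective rho v0 mu].
Proof.
move=> _ rhoP v0H muP Theta0 condA condB.
have AE : condA <-> ~ exists2 xi : 'Hom(V, R^o),
    xi <> 0 & constant_on_orbit rho v0 xi.
  by rewrite /condA (proper_affine_hullP rho v0 rhoP).
have AB : condA <-> condB.
  exact: iff_trans AE (spanning_orbit_no_constantP rho v0 rhoP).
split=> // [inj|Omega1 /AE]; last exact: no_constant_injective.
have A : condA.
  by apply/AE; exact: injective_no_constant Theta0 inj.
by split=> //; apply/AB.
Qed.
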